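(* Let $\alpha\in(0,1/2)$ and $r\in(0,1]$, and write $f=f_\alpha$, $f_k=f_{\alpha,k}$. For every $k\ge1$ such that $r>\alpha^k$, $$|\mathrm{c}_1^{f_k}(r)-\mathrm{c}_1^f(r)|<\frac{8}{2^k},\qquad |\mathrm{c}_\ell^{f_k}(r)-\mathrm{c}_\ell^f(r)|<\frac{16\,\ell}{2^k}\ \ (1<\ell<\infty),\qquad |\mathrm{c}_\infty^{f_k}(r)-\mathrm{c}_\infty^f(r)|<\frac{4}{2^k}.$$ If $r\in(\alpha^{h+1},\alpha^h]$ where $h\ge0$ is an integer, then (for every such $k$) $$\left|\mathrm{det}_\infty^{f_\alpha}(r)-\mathrm{det}_\infty^{f_{\alpha,k}}(r)\right|\le\frac{24}{2^{k-h-1}-8}.$$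
   Context: For $\alpha\in(0,1/2)$ the continuous map $f_\alpha:[0,1]\to[0,1]$ is defined by: $f_\alpha(x)=x-1+2\alpha^{j-1}-\alpha^j$ for $x\in[1-\alpha^{j-1},1-\alpha^{j-1}+\alpha^j]$, $j\ge1$; $f_\alpha(x)=\frac{1-\alpha+\alpha^2}{2\alpha-1}(x-1)+\alpha^{j+1}\frac{2-\alpha}{2\alpha-1}$ for $x\in(1-\alpha^{j-1}+\alpha^j,1-\alpha^j)$, $j\ge1$; and $f_\alpha(1)=0$. For $k\ge1$, $f_{\alpha,k}:[0,1]\to[0,1]$ is the continuous map equal to $f_\alpha$ on $[0,1-\alpha^{k-1}+\alpha^k]$, equal to $x-1+\alpha^k$ on $[1-\alpha^k,1]$, and linear in between. For a word $u=u_1\dots u_k\in\{0,1\}^k$ put $\kappa(u)=(1-\alpha)\sum_{i=1}^k u_i\alpha^{i-1}$ and $I_\alpha(u)=[\kappa(u),\kappa(u)+\alpha^k]$. The measure $\mu_\alpha$ is the unique Borel probability measure on $[0,1]$ with $\mu_\alpha(I_\alpha(u))=2^{-k}$ for all $k\ge1$, $u\in\{0,1\}^k$. The measure $\mu_{\alpha,k}$ is the uniform probability measure on the $f_{\alpha,k}$-orbit of $0$ (a periodic orbit with $2^k$ points, namely $\{\kappa(u):u\in\{0,1\}^k\}$). For $g=f_\alpha$ with $\nu=\mu_\alpha$, or $g=f_{\alpha,k}$ with $\nu=\mu_{\alpha,k}$, and $1\le\ell\le\infty$, $r>0$: $\varrho_\ell^g(x,y)=\sup\{|g^i(x)-g^i(y)|:0\le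 i<\ell\}$, $\mathrm{c}_\ell^g(r)=\nu\times\nu\{(x,y):\varrho_\ell^g(x,y)\le r\}$, and $\mathrm{det}_\infty^g(r)=\mathrm{c}_\infty^g(r)/\mathrm{c}_1^g(r)$.
   Formalization: The bound on the difference of determinisms is stated only for k with 2^{k-h-1} > 8; for smaller k its right-hand side is negative or undefined, so the printed inequality fails (e.g. r=1, h=0, k=1). *)

(* Defs.v *)
From HB Require Import structures.
From mathcomp Require Import all_boot all_order all_algebra.
From mathcomp Require Import all_classical all_reals all_analysis.

Set Implicit Arguments.
Unset Strict Implicit.
Unset Printing Implicit Defensive.
Import Order.TTheory GRing.Theory Num.Theory.
Import numFieldNormedType.Exports.

Local Open Scope classical_set_scope.
Local Open Scope ring_scope.

(* The state space [0, 1] is the subset `[0, 1] of R: self-maps of [0, 1] are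
   total functions R -> R whose values outside [0, 1] are irrelevant, and
   measures on [0, 1] are Borel measures on R (measurableTypeR R). *)

Section Maps.
Context {R : realType}.
Implicit Types alpha x : R.

(* For 0 <= x < 1, the only j >= 1 with x in [1 - alpha^(j-1), 1 - alpha^j[. *)
Definition level alpha x : nat :=
  get [set j : nat |
    (1 <= j)%N /\ 1 - alpha ^+ j.-1 <= x < 1 - alpha ^+ j].

Definition f_alpha alpha x : R :=
  let j := level alpha x in
  if x == 1 then 0
  else if x <= 1 - alpha ^+ j.-1 + alpha ^+ j then
    x - 1 + 2 * alpha ^+ j.-1 - alpha ^+ j
  else
    (1 - alpha + alpha ^+ 2) / (2 * alpha - 1) * (x - 1)
    + alpha ^+ j.+1 * ((2 - alpha) / (2 * alpha - 1)).

(* [line_path u v (factor a b x)] is the value at x of the affine function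
   taking the values u at a and v at b. *)
Definition f_trunc alpha (k : nat) x : R :=
  let a := 1 - alpha ^+ k.-1 + alpha ^+ k in
  let b := 1 - alpha ^+ k in
  if x <= a then f_alpha alpha x
  else if b <= x then x - 1 + alpha ^+ k
  else line_path (f_alpha alpha a) (b - 1 + alpha ^+ k) (factor a b x).

(* The i-th letter counted from 0 has weight alpha^i. *)
Definition kappa alpha (k : nat) (u : k.-tuple bool) : R :=
  (1 - alpha) * \sum_(i < k) (tnth u i)%:R * alpha ^+ i.

Definition cyl alpha (k : nat) (u : k.-tuple bool) : set R :=
  `[kappa alpha u, kappa alpha u + alpha ^+ k].

Definition orbit0 (g : R -> R) : set R := range (fun i : nat => iter i g 0).

Lemma level_eq alpha x (j : nat) : 0 < alpha < 1 / 2 -> (1 <= j)%N ->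
  1 - alpha ^+ j.-1 <= x < 1 - alpha ^+ j -> level alpha x = j.
Proof.
move=> /andP[a0 a12] j1 /andP[xj jx].
have a1 : alpha < 1 by rewrite (lt_trans a12)// ltr_pdivrMr// mul1r ltr1n.
apply: xget_unique => [|i [i1 /andP[xi ix]]]; first by split; rewrite ?xj.
have le_lev (m n : nat) : (1 <= n)%N -> 1 - alpha ^+ n.-1 < 1 - alpha ^+ m ->
    (n <= m)%N.
  move=> n1; rewrite ltrD2l ltrN2 ltr_iXn2l//.
  by rewrite -ltnS prednK.
apply/eqP; rewrite eqn_leq (le_lev _ _ i1 (le_lt_trans xi jx)).
exact: le_lev j1 (le_lt_trans xj ix).
Qed.

Lemma f_alpha_left alpha x (j : nat) : 0 < alpha < 1 / 2 -> (1 <= j)%N ->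
  x \in `[1 - alpha ^+ j.-1, 1 - alpha ^+ j.-1 + alpha ^+ j] ->
  f_alpha alpha x = x - 1 + 2 * alpha ^+ j.-1 - alpha ^+ j.
Proof.
move=> ha j1; rewrite in_itv/= => /andP[xj jx].
have /andP[a0 a12] := ha.
have aj : alpha ^+ j *+ 2 < alpha ^+ j.-1.
  rewrite -{1}(prednK j1) exprSr -mulrnAr gtr_pMr ?exprn_gt0//.
  by move: a12; rewrite ltr_pdivlMr// mulr_natr.
have xlt : x < 1 - alpha ^+ j.
  apply: (le_lt_trans jx); rewrite -addrA ltrD2l -ltrBrDr.
  by rewrite ltrNl opprD !opprK -mulr2n.
have x1 : x < 1 by rewrite (lt_trans xlt)// gtrDl oppr_lt0 exprn_gt0.
by rewrite /f_alpha (level_eq ha j1) ?xj// (lt_eqF x1) jx.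
Qed.

Lemma f_alpha_right alpha x (j : nat) : 0 < alpha < 1 / 2 -> (1 <= j)%N ->
  x \in `]1 - alpha ^+ j.-1 + alpha ^+ j, 1 - alpha ^+ j[ ->
  f_alpha alpha x = (1 - alpha + alpha ^+ 2) / (2 * alpha - 1) * (x - 1)
               + alpha ^+ j.+1 * ((2 - alpha) / (2 * alpha - 1)).
Proof.
move=> ha j1; rewrite in_itv/= => /andP[jx xj].
have /andP[a0 a12] := ha.
have lx : 1 - alpha ^+ j.-1 <= x.
  by rewrite (le_trans _ (ltW jx))// lerDl exprn_ge0// ltW.
have x1 : x < 1 by rewrite (lt_trans xj)// gtrDl oppr_lt0 exprn_gt0.
by rewrite /f_alpha (level_eq ha j1) ?lx// (lt_eqF x1) leNgt jx.
Qed.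

Lemma f_alpha_1 alpha : f_alpha alpha 1 = 0.
Proof. by rewrite /f_alpha eqxx. Qed.

Lemma measurable_orbit0 (g : R -> R) :
  measurable (orbit0 g : set (measurableTypeR R)).
Proof.
apply: countable_measurable => [t|]; first exact: measurable_set1.
exact: card_image_le.
Qed.

End Maps.

Section Measures.
Context {R : realType}.

(* These conditions determine mu. *)
Definition is_mu (alpha : R) (mu : probability (measurableTypeR R) R) : Prop :=
  mu `[0, 1]%classic = 1%E /\
  forall (k : nat) (u : k.-tuple bool), (1 <= k)%N ->
    mu (cyl alpha u) = (2 ^- k)%:E.

(* Counting measure on the orbit of 0 divided by the cardinality of the orbit;
   the Dirac mass is only the fallback of mnormalize for infinite orbits. *)
Definition mu_orbit0 (g : R -> R) : probability (measurableTypeR R) R :=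
  mnormalize (mrestr (@counting (measurableTypeR R) R) (measurable_orbit0 g))
             (@dirac _ (measurableTypeR R) 0 R).

Definition mu_trunc (alpha : R) (k : nat) : probability (measurableTypeR R) R :=
  mu_orbit0 (f_trunc alpha k).

(* In [rho], [corr] the parameter l with 1 <= l <= oo is represented by the
   index set J = {i | 0 <= i < l}: J = `I_l if l is finite, J = setT if
   l = oo. *)
Definition rho (g : R -> R) (J : set nat) (x y : R) : R :=
  sup [set `|iter i g x - iter i g y| | i in J].

Definition corr (g : R -> R) (nu : probability (measurableTypeR R) R)
    (J : set nat) (r : R) : R :=
  fine ((nu \x nu)%E [set xy : measurableTypeR R * measurableTypeR R |
    [/\ xy.1 \in `[0, 1], xy.2 \in `[0, 1] & rho g J xy.1 xy.2 <= r]]).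

Definition det_oo (g : R -> R) (nu : probability (measurableTypeR R) R)
    (r : R) : R :=
  corr g nu setT r / corr g nu `I_1 r.

End Measures.

(* Main.v *)
Require Import Defs.
From HB Require Import structures.
From mathcomp Require Import all_boot all_order all_algebra.
From mathcomp Require Import all_classical all_reals all_analysis.
From mathcomp Require Import ring lra zify.
Import Order.TTheory GRing.Theory Num.Theory.
Import numFieldNormedType.Exports.

Set Implicit Arguments.
Unset Strict Implicit.

Local Open Scope classical_set_scope.
Local Open Scope ring_scope.

(* Both maps act on the 2^k cylinders of order k as the odometer: f_alpha sends
   each cylinder into the next one, and f_trunc does the same with their left
   endpoints. Hence along the orbits of two cylinders the distances for f_alpha
   and f_trunc differ by at most alpha^k. If n(s) counts the pairs of words with
   rho <= s for f_trunc, then corr is n(r) / 4^k for f_trunc, and lies between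
   n(r - alpha^k) / 4^k and n(r + alpha^k) / 4^k for f_alpha. Since the endpoints
   are more than alpha^k apart, a half-open window of length alpha^k contains at
   most one of them, so n(s + alpha^k) - n(s) <= 2 l 2^k. For l = oo the
   constraint reduces to kappa(D) <= s and kappa(-D) <= s for the difference D
   of the two words, so that n(s + alpha^k) - n(s) <= 2 * 2^k. The bound on det
   follows because pairs with a common prefix of length h + 1 are at distance at
   most alpha^(h+1) < r, so corr at l = 1 is at least 2^-(h+1) for f_trunc. *)

(** * Left endpoints of the cylinders, and their distances under translation *)

Section BinaryWords.
Context {R : realType} (alpha : R).

(* The word of length k is encoded by the number n whose binary digits, lowest
   first, are its letters; only n modulo 2^k matters. The odometer acting on
   words becomes n |-> n + 1. *)
Fixpoint kappan (k n : nat) : R :=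
  if k is k'.+1 then (1 - alpha) * (odd n)%:R + alpha * kappan k' n./2 else 0.

Lemma kappanE k n : kappan k n =
  (1 - alpha) * \sum_(i < k) (odd (n %/ 2 ^ i))%:R * alpha ^+ i.
Proof.
elim: k n => [|k IH] n /=; first by rewrite big_ord0 mulr0.
rewrite big_ord_recl expn0 divn1 expr0 mulr1 mulrDr IH; congr (_ + _).
rewrite mulrCA mulr_sumr; congr (_ * _); apply: eq_bigr => i _.
by rewrite exprS expnS divnMA divn2 mulrCA.
Qed.

Lemma kappanDexp k n : kappan k (n + 2 ^ k) = kappan k n.
Proof.
elim: k n => [//|k IH] n /=.
by rewrite expnS mul2n oddD odd_double addbF halfD odd_double andbF add0n doubleK IH.
Qed.

Lemma kappan_mod k n : kappan k (n %% 2 ^ k) = kappan k n.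
Proof.
rewrite [in RHS](divn_eq n (2 ^ k)); elim: (n %/ _)%N => [//|q IH].
by rewrite mulSn -addnA addnC kappanDexp.
Qed.

Lemma kappan0 k : kappan k 0 = 0.
Proof. by elim: k => //= k ->; rewrite !mulr0 addr0. Qed.

Hypothesis ha : 0 < alpha < 1 / 2.
Let a0 : 0 < alpha. Proof. by case/andP: ha. Qed.
Let a1 : alpha < 1. Proof. by case/andP: ha => _ ?; lra. Qed.
Let a12 : alpha * 2 < 1. Proof. by case/andP: ha => _ ?; lra. Qed.

Lemma kappan_bound k n : 0 <= kappan k n <= 1 - alpha ^+ k.
Proof.
elim: k n => [|k IH] n /=; first by rewrite expr0 subrr lexx.
have /andP[h1 h2] := IH n./2; rewrite exprS.
have := ler_wpM2l (ltW a0) h1; have := ler_wpM2l (ltW a0) h2.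
by have := a1; case: odd => /= *; apply/andP; split; lra.
Qed.

(** Congruence modulo [2 ^ j] means that the first [j] letters agree; each common letter cancels and
    leaves a factor [alpha]. *)
Lemma kappan_near j k m n : (j <= k)%N -> (m = n %[mod 2 ^ j])%N ->
  `|kappan k m - kappan k n| <= alpha ^+ j.
Proof.
elim: j k m n => [|j IH] k m n.
  move=> _ _; have := kappan_bound k m; have := kappan_bound k n.
  have : 0 < alpha ^+ k by rewrite exprn_gt0.
  by rewrite expr0 ler_norml => ? /andP[? ?] /andP[? ?]; apply/andP; split; lra.
case: k => // k jk mn /=.
have om : odd m = odd n.
  have : (m = n %[mod 2])%N.
    by move/(congr1 (modn^~ 2%N)): mn; rewrite !modn_dvdm// expnS dvdn_mulr.
  by rewrite !modn2; case: odd; case: odd.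
have hm : (m./2 = n./2 %[mod 2 ^ j])%N.
  by move: mn; rewrite -!divn2 !modn_divl mulnC -expnS => ->.
rewrite om [X in `|X|](_ : _ = alpha * (kappan k m./2 - kappan k n./2)); last by ring.
by rewrite normrM gtr0_norm// exprS ler_wpM2l ?(ltW a0)// IH.
Qed.

(** Common letters factor out. At a differing letter, for words of length k + 1, the gap is at least
    (1 - alpha) - alpha (1 - alpha^k), which exceeds alpha^(k+1) because alpha < 1/2. *)
Lemma kappan_sep k m n : (m < 2 ^ k)%N -> (n < 2 ^ k)%N -> m != n ->
  alpha ^+ k < `|kappan k m - kappan k n|.
Proof.
elim: k m n => [|k IH] m n; first by rewrite expn0 !ltnS !leqn0 => /eqP-> /eqP->.
rewrite expnS => mk nk mn /=; have [om|om] := eqVneq (odd m) (odd n).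
  rewrite om [X in `|X|](_ : _ = alpha * (kappan k m./2 - kappan k n./2)); last by ring.
  rewrite normrM gtr0_norm// exprS ltr_pM2l//; apply: IH; [lia|lia|].
  by apply: contra mn => /eqP mn; rewrite -(odd_double_half m) om mn odd_double_half.
have /andP[m0 m1] := kappan_bound k m./2.
have /andP[n0 n1] := kappan_bound k n./2.
move: (ler_wpM2l (ltW a0) m0) (ler_wpM2l (ltW a0) m1).
move: (ler_wpM2l (ltW a0) n0) (ler_wpM2l (ltW a0) n1).
have := a12; rewrite exprS ltr_normr => *; apply/orP.
by case: (odd m) (odd n) om => -[]//= _; [left|right]; lra.
Qed.

(* A carry replaces two letters of weight alpha^i by one of weight alpha^(i+1). *)
Lemma kappanD k m n : kappan k (m + n) <= kappan k m + kappan k n.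
Proof.
elim: k m n => [|k IH] m n /=; first by rewrite addr0.
have {IH}h c : kappan k (c + (m./2 + n./2)) <=
    kappan k c + (kappan k m./2 + kappan k n./2).
  by rewrite (le_trans (IH _ _))// lerD2l.
have /andP[_ h1] : 0 <= kappan k 1 <= 1 - alpha ^+ k := kappan_bound k 1.
have hk : 0 < alpha ^+ k by rewrite exprn_gt0.
have := a12; have := a1; rewrite oddD halfD.
(* The conjunction is the carry out of the first letter. When it is 1, it adds at most alpha to the
   bound, while the two ones that it replaces weigh 2 (1 - alpha). *)
have /(ler_wpM2l (ltW a0)) := h (odd m && odd n).
case: (odd m); case: (odd n); rewrite /= ?kappan0 => *; try lra.
have : alpha * kappan k 1 <= alpha * (1 - alpha ^+ k) by rewrite ler_wpM2l// ltW.
have : 0 <= alpha * alpha ^+ k by rewrite mulr_ge0// ltW.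
lra.
Qed.

(** For k >= 1, this is the condition [rho <= s] for [f_trunc] between the endpoints of two
    cylinders, stated without iterating the map. *)
Definition close_words k (J : set nat) (s : R) (m n : nat) : Prop :=
  forall i, J i -> `|kappan k (i + m) - kappan k (i + n)| <= s.

(* By subadditivity of kappan, the largest distance between the translates of
   two words depends only on their difference, and is attained when one of the
   translates is 0. *)
Lemma close_wordsT k s m n : (m < 2 ^ k)%N -> (n < 2 ^ k)%N ->
  close_words k setT s m n <->
  kappan k (n + (2 ^ k - m)) <= s /\ kappan k (m + (2 ^ k - n)) <= s.
Proof.
move=> mk nk; split=> [h|[h1 h2] i _].
- have z : kappan k (2 ^ k) = 0 by rewrite -[(2 ^ k)%N]add0n kappanDexp kappan0.
  split.
    (* Translation by [2 ^ k - m], which stands for -m, brings the first word to [2 ^ k], that is,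
       to zero. *)
    have := h (2 ^ k - m)%N I; rewrite subnK ?(ltnW mk)// z sub0r normrN addnC.
    exact/le_trans/ler_norm.
  have := h (2 ^ k - n)%N I; rewrite subnK ?(ltnW nk)// z subr0 addnC.
  exact/le_trans/ler_norm.
- rewrite ler_norml; apply/andP; split.
  + have := kappanD k (i + m) (n + (2 ^ k - m)).
    rewrite (_ : (_ + (_ + (_ - m)))%N = (i + n + 2 ^ k)%N); last by lia.
    by rewrite kappanDexp => ?; lra.
  + have := kappanD k (i + n) (m + (2 ^ k - n)).
    rewrite (_ : (_ + (_ + (_ - n)))%N = (i + m + 2 ^ k)%N); last by lia.
    by rewrite kappanDexp => ?; lra.
Qed.

End BinaryWords.

(** * Action of the two maps on cylinders and on their left endpoints *)

Section Dynamics.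
Context {R : realType} (alpha : R).
Hypothesis ha : 0 < alpha < 1 / 2.
Let a0 : 0 < alpha. Proof. by case/andP: ha. Qed.
Let a1 : alpha < 1. Proof. by case/andP: ha => _ ?; lra. Qed.
Let a12 : alpha * 2 < 1. Proof. by case/andP: ha => _ ?; lra. Qed.
Local Notation kap := (kappan alpha).
Local Notation f := (f_alpha alpha).

Lemma level_exists x : 0 <= x < 1 ->
  exists2 j, (1 <= j)%N & 1 - alpha ^+ j.-1 <= x < 1 - alpha ^+ j.
Proof.
move=> /andP[x0 x1].
have ex : exists n, x < 1 - alpha ^+ n.
  have : alpha ^+ n @[n --> \oo] --> 0 by apply: cvg_expr; rewrite gtr0_norm.
  move=> /cvgrPdist_lt/(_ (1 - x)); rewrite subr_gt0 => /(_ x1) [n _ /(_ n (leqnn _))].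
  rewrite /= sub0r normrN ger0_norm ?exprn_ge0 ?ltW// => ?.
  by exists n; lra.
case: (ex_minnP ex) => -[|j] xj jmin.
  by move: xj; rewrite expr0 subrr ltNge x0.
exists j.+1 => //; rewrite xj andbT leNgt; apply/negP => /jmin.
by rewrite ltnn.
Qed.

Variant unit_pieces_spec x : Prop :=
  | PieceLeft j of (1 <= j)%N &
      1 - alpha ^+ j.-1 <= x <= 1 - alpha ^+ j.-1 + alpha ^+ j &
      f x = x - 1 + 2 * alpha ^+ j.-1 - alpha ^+ j
  | PieceRight j of (1 <= j)%N &
      1 - alpha ^+ j.-1 + alpha ^+ j < x < 1 - alpha ^+ j &
      f x = (1 - alpha + alpha ^+ 2) / (2 * alpha - 1) * (x - 1)
               + alpha ^+ j.+1 * ((2 - alpha) / (2 * alpha - 1))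
  | PieceOne of x = 1 & f x = 0.

Lemma unit_piecesP x : 0 <= x <= 1 -> unit_pieces_spec x.
Proof.
move=> /andP[x0]; rewrite le_eqVlt => /predU1P[->|x1].
  by apply: PieceOne => //; rewrite f_alpha_1.
have [|j j1 /andP[jx xj]] := @level_exists x; first by rewrite x0.
have [xl|xl] := leP x (1 - alpha ^+ j.-1 + alpha ^+ j).
  by apply: (@PieceLeft _ j) => //; [rewrite jx|apply: f_alpha_left; rewrite // in_itv/= jx].
by apply: (@PieceRight _ j) => //; [rewrite xl|apply: f_alpha_right; rewrite // in_itv/= xl].
Qed.

Lemma f_alpha_low x : 0 <= x <= alpha -> f x = x + 1 - alpha.
Proof.
move=> hx; rewrite (@f_alpha_left _ _ _ 1)//.
  by rewrite /= expr0 expr1; ring.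
by rewrite in_itv/= expr0 expr1 subrr add0r.
Qed.

(* [f_alpha] restricted to the cylinder of the words starting with 1 is a copy
   of [f_alpha] scaled by alpha. *)
Lemma f_alpha_scale y : 0 <= y <= 1 -> f (1 - alpha + alpha * y) = alpha * f y.
Proof.
case/unit_piecesP => [[//|j] _ /andP[yl yr] ->|[//|j] _ /andP[yl yr] ->|-> ->].
- rewrite (@f_alpha_left _ _ _ j.+2)//=; first by rewrite !exprS; ring.
  move: (ler_wpM2l (ltW a0) yl) (ler_wpM2l (ltW a0) yr).
  by rewrite in_itv/= !exprS => *; apply/andP; split; lra.
- rewrite (@f_alpha_right _ _ _ j.+2)//=; first by rewrite !exprS; ring.
  move: yl yr; rewrite -(ltr_pM2l a0) -[y < _](ltr_pM2l a0) => yl yr.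
  by move: yl yr; rewrite in_itv/= !exprS => *; apply/andP; split; lra.
- by rewrite mulr1 addrNK f_alpha_1 mulr0.
Qed.

Lemma f_alpha_unit x : 0 <= x <= 1 -> 0 <= f x <= 1.
Proof.
case/unit_piecesP => [[//|j] _|[//|j] _|_ ->]; last by rewrite lexx ler01.
all: rewrite /= !exprS => /andP[yl yr] ->.
all: have t1 : alpha ^+ j <= 1 by rewrite exprn_ile1// ltW.
all: move: (alpha ^+ j) t1 (exprn_gt0 j a0) yl yr => t t1 t0 yl yr.
all: have at0 : 0 < alpha * t by rewrite mulr_gt0.
all: have at1 : 0 < t * (1 - 2 * alpha) by rewrite mulr_gt0//; have := a12; lra.
- by apply/andP; split; lra.
- have D0 : 0 < 1 - 2 * alpha by have := a12; lra.
  rewrite (_ : _ + _ = ((1 - alpha + alpha ^+ 2) * (1 - x) -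
    alpha * (alpha * t) * (2 - alpha)) / (1 - 2 * alpha)); last first.
    by field; apply/andP; split; apply/eqP; have := a12; lra.
  have c0 : 0 <= 1 - alpha + alpha ^+ 2.
    by have := sqr_ge0 alpha; have := a1; lra.
  have xl : alpha * t <= 1 - x by lra.
  have xr : 1 - x <= t * (1 - alpha) by lra.
  have lo := ler_wpM2l c0 xl; have hi := ler_wpM2l c0 xr.
  (* The numerator is monotone in 1 - x. Its values at the two ends of the piece are the quantity of
     [p] (at 1 - x = alpha t) and that of [q] (at 1 - x = t (1 - alpha)). *)
  have p : 0 <= (alpha * t) * ((1 - alpha) * (1 - 2 * alpha)).
    by rewrite mulr_ge0 ?(ltW at0)// mulr_ge0 ?(ltW D0)//; have := a1; lra.
  have q : t * (1 - 2 * alpha) <= 1 - 2 * alpha by rewrite ger_pMl.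
  rewrite divr_ge0 ?(ltW D0)//= ?ler_pdivrMr// ?mul1r; lra.
Qed.

(** Induction on the first letter: a 0 becomes 1 by the translation of [f_alpha_low], and a 1
    becomes 0 while [f_alpha_scale] passes the carry on to the remaining letters. *)
Lemma f_alpha_cyl k n x : kap k n <= x <= kap k n + alpha ^+ k ->
  kap k n.+1 <= f x <= kap k n.+1 + alpha ^+ k.
Proof.
elim: k n x => [|k IH] n x /=; first by rewrite expr0 add0r; apply: f_alpha_unit.
have /andP[k0 k1] := kappan_bound ha k n./2.
rewrite exprS uphalf_half; case: (odd n) => /=; last first.
  have := ler_wpM2l (ltW a0) k0; have := ler_wpM2l (ltW a0) k1.
  move=> ? ? /andP[xl xr].
  by rewrite f_alpha_low; [apply/andP; split; lra|apply/andP; split; lra].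
move=> /andP[xl xr]; set y := (x - (1 - alpha)) / alpha.
have xy : x = 1 - alpha + alpha * y by rewrite /y; field; rewrite gt_eqF.
have yl : kap k n./2 <= y by rewrite -(ler_pM2l a0); move: xl; rewrite xy; lra.
have yr : y <= kap k n./2 + alpha ^+ k by rewrite -(ler_pM2l a0); move: xr; rewrite xy; lra.
have /andP[fl fr] := IH _ _ (introT andP (conj yl yr)).
move: (ler_wpM2l (ltW a0) fl) (ler_wpM2l (ltW a0) fr) => {}fl {}fr.
rewrite xy f_alpha_scale; first by move: fl fr; rewrite add1n => *; apply/andP; split; lra.
by apply/andP; split; lra.
Qed.

(** The all-ones word is excluded because [f_alpha] sends its endpoint to alpha^k - alpha^(k+1),
    which lies in the first cylinder but is not its left endpoint 0. *)
Lemma f_alpha_kappan k n : kap k n != 1 - alpha ^+ k ->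
  f (kap k n) = kap k n.+1.
Proof.
elim: k n => [|k IH] n /=; first by rewrite subrr eqxx.
have /andP[k0 k1] := kappan_bound ha k n./2.
have ak := exprn_gt0 k a0.
have := ler_wpM2l (ltW a0) k0; have := ler_wpM2l (ltW a0) k1 => ak1 ak0.
have : 0 < alpha * alpha ^+ k by rewrite mulr_gt0.
rewrite exprS uphalf_half; case: (odd n) => /= ? nk.
  rewrite mulr1 f_alpha_scale ?IH; [by rewrite add1n; ring| |apply/andP; split; lra].
  by apply: contra nk => /eqP ->; apply/eqP; ring.
by rewrite f_alpha_low; [ring|apply/andP; split; lra].
Qed.

(** Keeps every endpoint but the last in the range where [f_trunc] coincides with [f_alpha]; the
    final affine piece of [f_trunc] then returns the last one to 0. *)
Lemma kappan_lt_last k n : (1 <= k)%N -> kap k n != 1 - alpha ^+ k ->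
  kap k n <= 1 - alpha ^+ k.-1 + alpha ^+ k.
Proof.
case: k => // k _; rewrite succnK; elim: k n => [|k IH] n.
  rewrite /= mulr0 addr0 expr1 expr0; case: odd => /=; first by rewrite mulr1 eqxx.
  by rewrite mulr0 subrr add0r ltW.
have /andP[k0 k1] := kappan_bound ha k.+1 n./2.
rewrite (_ : kap k.+2 n = (1 - alpha) * (odd n)%:R + alpha * kap k.+1 n./2)//.
move: IH k0 k1; move: (kap k.+1) => K IH k0 k1.
move: (IH n./2) (ler_wpM2l (ltW a0) k1).
have t1 : alpha ^+ k <= 1 by rewrite exprn_ile1// ltW.
rewrite !exprS; move: (alpha ^+ k) t1 (exprn_gt0 k a0) => t t1 t0 {}IH K1.
have ? : 0 <= (1 - alpha * t) * (1 - 2 * alpha).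
  have at1 : alpha * t <= 1 by rewrite mulr_ile1// ltW.
  by apply: mulr_ge0; have := a12; lra.
case: odd => /= nk; last by have := a0; lra.
suff /IH/(ler_wpM2l (ltW a0)) : K n./2 != 1 - alpha * t by lra.
by apply: contra nk => /eqP ->; apply/eqP; ring.
Qed.

Lemma kappan_last k n : kap k n = 1 - alpha ^+ k -> kap k n.+1 = 0.
Proof.
elim: k n => //= k IH n; rewrite exprS uphalf_half.
have /andP[_ /(ler_wpM2l (ltW a0))] := kappan_bound ha k n./2.
case: (odd n) => /= kn e; last by have := a1; lra.
rewrite add1n IH; first by rewrite !mulr0 addr0.
by apply: (mulfI (lt0r_neq0 a0)); lra.
Qed.

Local Notation g := (f_trunc alpha).

Lemma trunc_knots k : (1 <= k)%N ->
  1 - alpha ^+ k.-1 + alpha ^+ k < 1 - alpha ^+ k.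
Proof.
case: k => // k _ /=; rewrite exprS.
have : 0 < alpha ^+ k * (1 - 2 * alpha) by rewrite mulr_gt0 ?exprn_gt0//; have := a12; lra.
by lra.
Qed.

Lemma f_trunc_kappan k n : (1 <= k)%N -> g k (kap k n) = kap k n.+1.
Proof.
move=> k1; rewrite /f_trunc; have [e|ne] := eqVneq (kap k n) (1 - alpha ^+ k).
  rewrite e leNgt trunc_knots// lexx /=.
  rewrite (_ : _ + _ = 0); last by ring.
  by rewrite kappan_last.
by rewrite kappan_lt_last// f_alpha_kappan.
Qed.

Lemma iter_f_trunc_kappan k i n : (1 <= k)%N ->
  iter i (g k) (kap k n) = kap k (i + n).
Proof. by move=> k1; elim: i => //= i ->; rewrite f_trunc_kappan. Qed.

Lemma f_trunc_unit k x : (1 <= k)%N -> 0 <= x <= 1 -> 0 <= g k x <= 1.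
Proof.
move=> k1 x01; have kn := trunc_knots k1.
have akk : alpha ^+ k <= alpha ^+ k.-1 by rewrite -{1}(prednK k1) exprS ger_pMl ?exprn_gt0 ?ltW.
have ak := exprn_gt0 k a0.
have ak1 : alpha ^+ k.-1 <= 1 by rewrite exprn_ile1// ltW.
rewrite /f_trunc; case: ifPn => [_|]; first exact: f_alpha_unit.
rewrite -ltNge => ax; case: ifPn => [bx|].
  by case/andP: x01 => *; apply/andP; split; lra.
rewrite -ltNge => xb.
set u := f_alpha _ _.
have /andP[u0 u1] : 0 <= u <= 1.
  by apply: f_alpha_unit; apply/andP; split; lra.
(* The middle piece ends at height 0, so its values are [(1 - t) * u] with [t] and [u] in [0, 1]. *)
rewrite (_ : _ + _ = 0); last by ring.
rewrite /line_path mulr0 addr0.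
set t := factor _ _ _.
have /andP[t0 t1] : 0 <= t <= 1.
  rewrite /t /factor; apply/andP; split.
    by rewrite divr_ge0// subr_ge0 ltW.
  by rewrite ler_pdivrMr ?subr_gt0// mul1r lerD2r ltW.
rewrite mulr_ge0 ?subr_ge0//= -[leRHS]mul1r ler_pM ?subr_ge0//; lra.
Qed.

End Dynamics.

(** * Counting the pairs of words that a larger threshold adds *)

Lemma leq_card_pairs (C T T' : finType) (A : {set T * T'})
    (Q : C -> T -> T' -> Prop) :
  (forall m n, (m, n) \in A -> exists c, Q c m n) ->
  (forall c m n n', Q c m n -> Q c m n' -> n = n') ->
  (#|A| <= #|C| * #|T|)%N.
Proof.
move=> PQ Qinj.
have PQ' (p : T * T') : exists co : option C, p \in A -> if co is Some c then Q c p.1 p.2 else False.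
  case: p => m n; have [/PQ[c Qc]|_] := boolP ((m, n) \in A); first by exists (Some c).
  by exists None.
pose h p := sval (cid (PQ' p)).
have hP p : p \in A -> if h p is Some c then Q c p.1 p.2 else False := svalP (cid (PQ' p)).
rewrite -card_prod.
(* A label and the first component determine the pair, by [Qinj]. The value [None] only makes the
   labelling total; it does not occur on [A]. *)
pose F p : option C * T := (h p, p.1).
have Finj : {in A &, injective F}.
  move=> [m n] [m' n'] /= /hP hp /hP hp' [e mm].
  move: hp hp'; rewrite -e -mm; case: (h _) => //= c q q'.
  by rewrite (Qinj _ _ _ _ q q').
rewrite -(card_in_imset Finj) -[leqRHS](card_imset predT (_ : injective (fun x : C * T => (Some x.1, x.2)))); last first.
  by move=> [? ?] [? ?] /= [-> ->].
apply/subset_leq_card/fintype.subsetP => y /imsetP[[m n]] /hP + {y}->.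
rewrite /F; case: (h _) => //= c _.
by apply/imsetP; exists (c, m).
Qed.

Section Counting.
Context {R : realType} (alpha : R).
Hypothesis ha : 0 < alpha < 1 / 2.
Local Notation kap := (kappan alpha).

Definition close_set k (J : set nat) (s : R) : {set 'I_(2 ^ k) * 'I_(2 ^ k)} :=
  [set p : 'I_(2 ^ k) * 'I_(2 ^ k) | `[< close_words alpha k J s p.1 p.2 >]]%SET.

Lemma close_setP k J s (p : 'I_(2 ^ k) * 'I_(2 ^ k)) :
  reflect (close_words alpha k J s p.1 p.2) (p \in close_set k J s).
Proof. by rewrite inE; exact: asboolP. Qed.

Lemma kappan_eqmod k m n : kap k m - kap k n <= alpha ^+ k ->
  kap k n - kap k m <= alpha ^+ k -> m = n %[mod 2 ^ k].
Proof.
have p2 : (0 < 2 ^ k)%N by rewrite expn_gt0.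
rewrite -(kappan_mod _ _ m) -(kappan_mod _ _ n) => h1 h2.
apply/eqP; apply/negP => /negP ne.
have := kappan_sep ha (ltn_pmod m p2) (ltn_pmod n p2) ne.
by rewrite ltr_normr => /orP[]; lra.
Qed.

(** By [close_wordsT], an added pair has one of its two differences with endpoint in ]s, s +
    alpha^k]. The sign [b] and [m] then determine [n], hence the factor 2. *)
Lemma card_closeD_setT k s :
  (#|close_set k setT (s + alpha ^+ k) :\: close_set k setT s| <= 2 * 2 ^ k)%N.
Proof.
pose D (b : bool) (m n : 'I_(2 ^ k)) : nat :=
  if b then (n + (2 ^ k - m))%N else (m + (2 ^ k - n))%N.
pose Q b m n : Prop := s < kap k (D b m n) <= s + alpha ^+ k.
apply: leq_trans (leq_card_pairs (Q := Q) _ _) _; last by rewrite card_bool card_ord.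
  move=> m n; rewrite finset.in_setD => /andP[/close_setP h1 /close_setP h2].
  move: h2 => /(close_wordsT ha _ (ltn_ord _) (ltn_ord _))[/= d1 d2].
  have [e1|e1] := leP (kap k (D true m n)) s.
    exists false; rewrite /Q d2 andbT ltNge; apply/negP => e2; apply: h1.
    exact/(close_wordsT ha _ (ltn_ord _) (ltn_ord _)).
  by exists true; rewrite /Q d1 e1.
move=> b m n n' /andP[h1 h2] /andP[h3 h4].
have : D b m n = D b m n' %[mod 2 ^ k] by apply: kappan_eqmod; lra.
rewrite /D {h1 h2 h3 h4}.
have [mk nk nk'] := And3 (ltn_ord m) (ltn_ord n) (ltn_ord n').
case: b => e; apply: val_inj => /=.
  move: e => /eqP; rewrite eqn_modDr !modn_small// => /eqP.
  by [].
move: e => /eqP; rewrite eqn_modDl => /eqP e.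
(* Adding [n] and [n'] to both sides clears the natural-number subtractions. *)
have : (n + (2 ^ k - n) + n' = n + (2 ^ k - n') + n' %[mod 2 ^ k])%N.
  by apply/eqP; rewrite eqn_modDr eqn_modDl; apply/eqP.
rewrite (_ : (n + (2 ^ k - n) + n' = n' + 2 ^ k)%N); last by lia.
rewrite (_ : (n + (2 ^ k - n') + n' = n + 2 ^ k)%N); last by lia.
by rewrite !modnDr !modn_small.
Qed.

(** An added pair is labelled by a time [i < l] at which the distance exceeds [s], and by the sign
    of the difference there. Given the label and [m], the window of length alpha^k determines
    [n]. *)
Lemma card_closeD k l s :
  (#|close_set k `I_l (s + alpha ^+ k) :\: close_set k `I_l s| <= 2 * l * 2 ^ k)%N.
Proof.
pose Q (c : bool * 'I_l) (m n : 'I_(2 ^ k)) : Prop :=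
  if c.1 then s < kap k (c.2 + n) - kap k (c.2 + m) <= s + alpha ^+ k
  else s < kap k (c.2 + m) - kap k (c.2 + n) <= s + alpha ^+ k.
apply: leq_trans (leq_card_pairs (Q := Q) _ _) _; last by rewrite card_prod card_bool !card_ord.
  move=> m n; rewrite finset.in_setD => /andP[/close_setP h1 /close_setP h2].
  have [i il hi] : exists2 i, (i < l)%N & s < `|kap k (i + m) - kap k (i + n)|.
    apply: contrapT => h; apply: h1 => i il.
    by rewrite leNgt; apply/negP => hi; apply: h; exists i.
  move: (h2 i il); rewrite ler_norml /= => /andP[lo hi'].
  move: hi; rewrite ltr_normr => /orP[] hi.
    by exists (false, Ordinal il); rewrite /Q /= hi hi'.
  by exists (true, Ordinal il); rewrite /Q /=; apply/andP; split; lra.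
move=> [b i] m n n' q q'; apply: val_inj => /=.
suff : (i + n = i + n' %[mod 2 ^ k])%N.
  by move/eqP; rewrite eqn_modDl !modn_small// => /eqP.
by case: b q q'; rewrite /Q /= => /andP[h1 h2] /andP[h3 h4]; apply: kappan_eqmod; lra.
Qed.

End Counting.

(** * Bounding probabilities by counting disjoint pieces of equal mass *)

Section EquallyLikely.
Context {d : measure_display} {T : measurableType d} {R : realType}.
Context (P : probability T R) (I : finType) (F : I -> set T) (c : R).
Hypothesis Fm : forall i, measurable (F i).
Hypothesis Ft : trivIset setT F.
Hypothesis Fc : forall i, P (F i) = c%:E.

Lemma fine_probability_ge (A : {set I}) (S : set T) : measurable S ->
  (forall i, i \in A -> F i `<=` S) -> #|A|%:R * c <= fine (P S).
Proof.
move=> mS AS.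
have mU : measurable (\bigcup_(i in [set` enum A]) F i).
  by apply: fin_bigcup_measurable => //; exact: finite_seq.
rewrite -lee_fin fineK ?fin_num_measure//.
apply: (@le_trans _ _ (P (\bigcup_(i in [set` enum A]) F i))).
  rewrite measure_fin_bigcup//; last by exact: sub_trivIset Ft.
  rewrite -fsbig_seq ?enum_uniq//= (eq_bigr (fun=> c%:E)); last by move=> i _; apply: Fc.
  rewrite sumEFin big_const_seq count_predT iter_addr addr0 -cardE mulr_natl.
  exact: lexx.
apply: le_measure; rewrite ?inE// => x [i].
by rewrite /= mem_enum => iA Fx; exact: AS Fx.
Qed.

(** The pieces have total mass 1, so the lower bound, applied to the complements of [S] and [A],
    gives the upper bound. *)
Lemma fine_probability_le (A : {set I}) (S : set T) : #|I|%:R * c = 1 ->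
  measurable S -> (forall i x, S x -> F i x -> i \in A) ->
  fine (P S) <= #|A|%:R * c.
Proof.
move=> Ic mS AS.
have := @fine_probability_ge (~: A)%SET (~` S) (measurableC mS).
rewrite probability_setC// fineB ?fin_num_measure//=.
have e : #|A|%:R * c + #|(~: A)%SET|%:R * c = 1.
  by rewrite -mulrDl -natrD cardsC.
move=> h; suff /h : forall i, i \in (~: A)%SET -> F i `<=` ~` S.
  by rewrite lerBrDl -[leRHS]e lerD2r.
move=> i; rewrite finset.in_setC => iA x Fx Sx.
by rewrite (AS i x) in iA.
Qed.

End EquallyLikely.

(** * Correlation integrals: measurability, and bounds by counting product cells *)

Section Correlation.
Context {R : realType}.
Implicit Types (g : R -> R) (J : set nat).

Local Notation I01 := (`[0 : R, 1]%classic : set R).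

Lemma iter_unit g i x : (forall x, 0 <= x <= 1 -> 0 <= g x <= 1) ->
  0 <= x <= 1 -> 0 <= iter i g x <= 1.
Proof. by move=> gu x01; elim: i => //= i; exact: gu. Qed.

(** A [sup] is a genuine supremum only on a nonempty bounded set: [J] is nonempty, and the orbits
    stay in [0, 1], so that 1 is an upper bound. *)
Lemma rho_leP g J x y r : (forall x, 0 <= x <= 1 -> 0 <= g x <= 1) ->
  J !=set0 -> 0 <= x <= 1 -> 0 <= y <= 1 ->
  rho g J x y <= r <-> forall i, J i -> `|iter i g x - iter i g y| <= r.
Proof.
move=> gu J0 x01 y01; split=> [h i Ji|h].
  apply: le_trans h; apply: ub_le_sup; last by exists i.
  exists 1 => _ [j _ <-].
  have /andP[? ?] := iter_unit j gu x01; have /andP[? ?] := iter_unit j gu y01.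
  by rewrite ler_norml; apply/andP; split; lra.
apply: ge_sup; first by case: J0 => i Ji; exists `|iter i g x - iter i g y|; exists i.
by move=> _ [i Ji <-]; exact: h.
Qed.

Definition corr_set g J r : set (R * R) :=
  [set xy | [/\ xy.1 \in `[0, 1], xy.2 \in `[0, 1] & rho g J xy.1 xy.2 <= r]].

(** The condition on [rho] is a countable intersection, over the times in [J], of closed conditions
    on measurable functions. *)
Lemma measurable_corr_set g J r :
  (forall x, 0 <= x <= 1 -> 0 <= g x <= 1) ->
  measurable_fun I01 g -> J !=set0 ->
  measurable (corr_set g J r).
Proof.
move=> gu gm J0.
have m01 : measurable I01 by exact: measurable_itv.
have im i : measurable_fun I01 (iter i g).
  elim: i => [|i IH]; first exact: measurable_id.
  apply: (@measurable_comp _ _ _ _ _ _ I01 g _ (iter i g)) => // _ [x /= x01 <-].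
  by move: x01; rewrite !in_itv /=; exact: iter_unit.
pose D := (I01 `*` I01) : set (R * R).
have mD : measurable D by exact: measurableX.
rewrite (_ : corr_set g J r = \bigcap_(i in J)
   (D `&` (fun xy => `|iter i g xy.1 - iter i g xy.2|) @^-1` `]-oo, r])).
  apply: bigcap_measurable => // i _.
  have fst01 (p : R * R -> R) : measurable_fun setT p -> p @` D `<=` I01 ->
      measurable_fun D (iter i g \o p).
    move=> mp pD; apply: (measurable_comp m01 pD (im i)).
    exact: measurable_funTS.
  have h : measurable_fun D ((iter i g \o fst) \- (iter i g \o snd)).
    apply: measurable_realfun.measurable_funB; apply: fst01 => //.
      by move=> _ [x [? ?] <-].
    by move=> _ [x [? ?] <-].
  have := measurableT_comp (@measurable_realfun.normr_measurable R setT) h.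
  by apply => //; exact: measurable_itv.
apply/seteqP; split=> [[x y] [/= x01 y01 h] i Ji|[x y] h].
  split => //=; rewrite in_itv/=; move: i Ji; apply/rho_leP => //.
have [i Ji] := J0; have [[/= x01 y01] _] := h i Ji.
split=> //; apply/rho_leP => // j Jj; have [_] := h j Jj.
by rewrite /= in_itv.
Qed.

Context (nu : probability (measurableTypeR R) R) (N : nat).
Context (E : 'I_N -> set (measurableTypeR R)).
Hypothesis Em : forall i, measurable (E i).
Hypothesis Et : trivIset setT E.
Hypothesis Ec : forall i, nu (E i) = (N%:R^-1)%:E.

Let F (p : 'I_N * 'I_N) := E p.1 `*` E p.2.

Let Fm p : measurable (F p). Proof. exact: measurableX. Qed.

Let Ft : trivIset setT F.
Proof.
move=> [m n] [m' n'] _ _ [[x y] [[/= h1 h2] [/= h3 h4]]].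
by congr (_, _); apply: Et => //; [exists x|exists y].
Qed.

Let Fc p : (nu \x nu)%E (F p) = ((N ^ 2)%:R^-1)%:E.
Proof.
rewrite /F product_measure1E//.
transitivity ((N%:R^-1)%:E * (N%:R^-1)%:E : \bar R)%E.
  by congr (_ * _)%E; exact: Ec.
by rewrite -EFinM -invfM -natrM.
Qed.

Lemma corr_ge g J r (A : {set 'I_N * 'I_N}) :
  measurable (corr_set g J r) ->
  (forall p, p \in A -> E p.1 `*` E p.2 `<=` corr_set g J r) ->
  #|A|%:R / (N ^ 2)%:R <= corr g nu J r.
Proof. by move=> mS; exact: (fine_probability_ge Fm Ft Fc mS). Qed.

Lemma corr_le g J r (A : {set 'I_N * 'I_N}) : (0 < N)%N ->
  measurable (corr_set g J r) ->
  (forall p xy, corr_set g J r xy -> E p.1 xy.1 -> E p.2 xy.2 -> p \in A) ->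
  corr g nu J r <= #|A|%:R / (N ^ 2)%:R.
Proof.
move=> N0 mS AS; apply: (fine_probability_le Fm Ft Fc _ mS).
  by rewrite card_prod card_ord divff// pnatr_eq0 -lt0n muln_gt0 N0.
by move=> p xy Sxy [e1 e2]; exact: AS Sxy e1 e2.
Qed.

End Correlation.

(** * Measurability of the two maps; masses of cylinders and of orbit points *)

Section Masses.
Context {R : realType} (alpha : R).
Hypothesis ha : 0 < alpha < 1 / 2.
Let a0 : 0 < alpha. Proof. by case/andP: ha. Qed.
Let a1 : alpha < 1. Proof. by case/andP: ha => _ ?; lra. Qed.
Local Notation kap := (kappan alpha).
Local Notation I01 := (`[0 : R, 1]%classic : set R).

Lemma measurable_affine (D : set R) (a b : R) : measurable_fun D (fun x => a * x + b).
Proof.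
by apply: measurable_realfun.measurable_funD => //; apply: measurable_realfun.measurable_funM.
Qed.

(** The pieces accumulate at 1, which is treated apart; the rest is a countable union of intervals
    [E n], the points of level n + 1, each carrying two affine pieces. *)
Lemma measurable_f_alpha : measurable_fun I01 (f_alpha alpha).
Proof.
pose E n : set R := [set` `[1 - alpha ^+ n, 1 - alpha ^+ n.+1[ ].
have mE n : measurable (E n) by exact: measurable_itv.
have -> : I01 = [set 1] `|` \bigcup_n E n.
  apply/seteqP; split=> x; rewrite /= in_itv/=.
    move=> /andP[x0]; rewrite le_eqVlt => /predU1P[->|x1]; first by left.
    have [|[//|j] _ xj] := @level_exists _ alpha ha x; first by rewrite x0.
    by right; exists j => //; rewrite /E /= in_itv.
  case=> [->|[n _]]; first by rewrite ler01 lexx.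
  rewrite /E /= in_itv/= => /andP[h1 h2].
  have h3 : alpha ^+ n <= 1 by rewrite exprn_ile1// ltW.
  have h4 : 0 < alpha ^+ n.+1 by rewrite exprn_gt0.
  by apply/andP; split; lra.
apply/measurable_funU => //; first by apply: bigcup_measurable.
split; first exact: measurable_fun_set1.
apply/measurable_fun_bigcup => // n.
pose h x := if x <= 1 - alpha ^+ n + alpha ^+ n.+1 then 1 * x + (2 * alpha ^+ n - alpha ^+ n.+1 - 1)
  else (1 - alpha + alpha ^+ 2) / (2 * alpha - 1) * x
     + (alpha ^+ n.+2 * ((2 - alpha) / (2 * alpha - 1)) - (1 - alpha + alpha ^+ 2) / (2 * alpha - 1)).
apply: (@eq_measurable_fun _ _ _ _ _ h).
  move=> x; rewrite inE /E /= in_itv/= => /andP[xl xr]; rewrite /h.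
  case: ifPn; rewrite -?ltNge => xm.
    by rewrite (@f_alpha_left _ _ _ n.+1) ?in_itv/= ?xl//; ring.
  rewrite (@f_alpha_right _ _ _ n.+1) ?in_itv/= ?xr ?andbT//.
  by move: (_ / _) (_ / _) => u v; ring.
apply: measurable_funTS; apply: measurable_fun_ifT; [|exact: measurable_affine..].
exact: measurable_realfun.measurable_fun_ler.
Qed.

Lemma measurable_f_trunc k : measurable_fun I01 (f_trunc alpha k).
Proof.
have mI : measurable I01 by exact: measurable_itv.
have mle c : measurable_fun setT (fun x : R => x <= c) by exact: measurable_realfun.measurable_fun_ler.
have mge c : measurable_fun setT (fun x : R => c <= x) by exact: measurable_realfun.measurable_fun_ler.
apply: measurable_fun_if => //; first exact: measurable_funTS (mle _).
  by apply: measurable_funS measurable_f_alpha => // x [].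
apply: measurable_funTS; apply: measurable_fun_ifT => //.
  apply: (@eq_measurable_fun _ _ _ _ _ (fun x : R => 1 * x + (alpha ^+ k - 1))).
    by move=> x _; ring.
  exact: measurable_affine.
set u := f_alpha _ _; set v := _ - 1 + _; set a := (X in factor X); set b := 1 - _.
apply: (@eq_measurable_fun _ _ _ _ _ (fun x : R => (v - u) / (b - a) * x + (u - a * ((v - u) / (b - a))))).
  by move=> x _; rewrite /line_path /factor; move: (_^-1) => w; ring.
exact: measurable_affine.
Qed.

Definition cyln k n : set (measurableTypeR R) := `[kap k n, kap k n + alpha ^+ k]%classic.

Lemma trivIset_cyln k : trivIset setT (fun n : 'I_(2 ^ k) => cyln k n).
Proof.
move=> m n _ _ [x []]; rewrite /cyln /= !in_itv/= => /andP[h1 h2] /andP[h3 h4].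
have := @kappan_eqmod _ _ ha k m n; rewrite !modn_small//.
by move=> h; apply: val_inj; apply: h; lra.
Qed.

Lemma is_mu_cyln (mu : probability (measurableTypeR R) R) k n :
  is_mu alpha mu -> (1 <= k)%N -> mu (cyln k n) = ((2 ^ k)%:R^-1)%:E.
Proof.
move=> [_ hmu] k1; have := hmu k [tuple odd (n %/ 2 ^ i) | i < k] k1.
rewrite natrX => <-; congr (mu _); rewrite /cyl.
suff -> : kappa alpha [tuple odd (n %/ 2 ^ i) | i < k] = kap k n by [].
rewrite kappanE /kappa; congr (_ * _); apply: eq_bigr => i _.
by rewrite tnth_mktuple.
Qed.

Lemma trivIset_kappan k :
  trivIset setT (fun n : 'I_(2 ^ k) => [set kap k n] : set (measurableTypeR R)).
Proof.
move=> m n _ _ [x [/= -> e]]; apply: val_inj; rewrite /= -(modn_small (ltn_ord m)).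
rewrite -(modn_small (ltn_ord n)); apply: (kappan_eqmod ha).
all: by rewrite e subrr exprn_ge0// ltW.
Qed.

Lemma orbit0_f_trunc k : (1 <= k)%N ->
  orbit0 (f_trunc alpha k) = kap k @` `I_(2 ^ k).
Proof.
move=> k1; apply/seteqP; split=> _ [n _ <-].
  exists (n %% 2 ^ k)%N; first by rewrite /= ltn_mod expn_gt0.
  by rewrite kappan_mod -(kappan0 alpha k) iter_f_trunc_kappan// addn0.
by exists n => //; rewrite -[X in iter _ _ X](kappan0 alpha k) iter_f_trunc_kappan// addn0.
Qed.

Lemma mu_trunc_kappan k (n : 'I_(2 ^ k)) : (1 <= k)%N ->
  mu_trunc alpha k [set kap k n] = ((2 ^ k)%:R^-1)%:E.
Proof.
move=> k1.
have orbN : (orbit0 (f_trunc alpha k) #= `I_(2 ^ k))%card.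
  rewrite orbit0_f_trunc//; apply: inj_card_eq => x y.
  rewrite !inE /= => xk yk e; rewrite -(modn_small xk) -(modn_small yk).
  by apply: (kappan_eqmod ha); rewrite e subrr exprn_ge0// ltW.
have orbf : finite_set (orbit0 (f_trunc alpha k)) by exists (2 ^ k)%N.
pose m : {measure set (measurableTypeR R) -> \bar R} :=
  mrestr (@counting (measurableTypeR R) R) (measurable_orbit0 (f_trunc alpha k)).
have ev : m setT = ((2 ^ k)%:R)%:E.
  by rewrite /m /= /mrestr setTI /counting asboolT// (card_fset_set orbN).
have pt : m [set kap k n] = 1%:E.
  rewrite /m /= /mrestr (_ : _ `&` _ = [set kap k n]); last first.
    by apply/setIidl => _ ->; rewrite orbit0_f_trunc//; exists n => //=; exact: ltn_ord.
  by rewrite /counting asboolT// fset_set1 finmap.cardfs1.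
change (mnormalize m (@dirac _ (measurableTypeR R) 0 R) [set kap k n]
  = ((2 ^ k)%:R^-1)%:E).
(* The Dirac fallback applies only to total mass 0 or infinity; by [ev] the total mass is
   [2 ^ k]. *)
rewrite /mnormalize ev eqe pnatr_eq0 -leqn0 leqNgt expn_gt0 /=.
by rewrite [X in (X * _)%E]pt mul1e.
Qed.

End Masses.

(** * Comparing the correlations and determinisms of the two maps *)

Lemma norm_ratioB {R : realFieldType} (a b a' b' : R) : 0 < b -> 0 < b' ->
  0 <= a' <= b' -> `|a / b - a' / b'| <= (`|a - a'| + `|b - b'|) / b.
Proof.
move=> b0 b0' /andP[a0 ab].
(* In this form the coefficient of [b - b'] is the ratio [a' / b'], which lies in [0, 1]. *)
have -> : a / b - a' / b' = ((a - a') - a' / b' * (b - b')) / b.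
  by field; rewrite !gt_eqF.
rewrite normrM (gtr0_norm (x := b^-1)) ?invr_gt0// ler_pM2r ?invr_gt0//.
rewrite (le_trans (ler_normB _ _))// lerD2l normrM ger0_norm ?divr_ge0 ?(ltW b0')//.
by rewrite ler_piMl// ler_pdivrMr// mul1r.
Qed.

Section Comparison.
Context {R : realType} (alpha : R).
Hypothesis ha : 0 < alpha < 1 / 2.
Let a0 : 0 < alpha. Proof. by case/andP: ha. Qed.
Local Notation kap := (kappan alpha).
Local Notation f := (f_alpha alpha).

Lemma kappan_unit k n : 0 <= kap k n <= 1.
Proof.
have /andP[-> h] := kappan_bound ha k n; rewrite (le_trans h)// gerBl.
by rewrite exprn_ge0// ltW.
Qed.

Lemma cyln_unit k n x : cyln alpha k n x -> 0 <= x <= 1.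
Proof.
rewrite /cyln /= in_itv/= => /andP[h1 h2]; have /andP[h3 h4] := kappan_bound ha k n.
by apply/andP; split; lra.
Qed.

Lemma iter_f_alpha_cyln k n i x : cyln alpha k n x -> cyln alpha k (i + n) (iter i f x).
Proof.
move=> kx; elim: i => //= i; rewrite /cyln /= !in_itv/=; exact: f_alpha_cyl.
Qed.

(** The orbit points carry all the mass and [f_trunc] acts on them as n |-> n + 1, so the same set
    of pairs serves for both counting bounds. *)
Lemma corr_f_trunc k J r : (1 <= k)%N -> J !=set0 ->
  corr (f_trunc alpha k) (mu_trunc alpha k) J r =
  #|close_set alpha k J r|%:R / ((2 ^ k) ^ 2)%:R.
Proof.
move=> k1 J0.
have gu x : 0 <= x <= 1 -> 0 <= f_trunc alpha k x <= 1 by exact: f_trunc_unit.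
have mS : measurable (corr_set (f_trunc alpha k) J r).
  by apply: measurable_corr_set => //; exact: measurable_f_trunc.
have rhoE m n : rho (f_trunc alpha k) J (kap k m) (kap k n) <= r <-> close_words alpha k J r m n.
  apply: (iff_trans (rho_leP _ gu J0 (kappan_unit _ _) (kappan_unit _ _))).
  by split=> h i Ji; have := h i Ji; rewrite !iter_f_trunc_kappan.
have E1 := @trivIset_kappan _ _ ha k; have E2 := fun n => @mu_trunc_kappan _ _ ha k n k1.
have Em (n : 'I_(2 ^ k)) : measurable ([set kap k n] : set (measurableTypeR R)).
  exact: measurable_set1.
apply/le_anti/andP; split.
  apply: (corr_le Em E1 E2) => //.
  - by rewrite expn_gt0.
  - by move=> p [x y] [_ _ /= h] /= xE yE; apply/close_setP/rhoE; rewrite -xE -yE.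
apply: (corr_ge Em E1 E2) => //.
move=> p /close_setP/rhoE h [x y] [/= -> ->].
by split => //=; rewrite in_itv/= kappan_unit.
Qed.

Context (mu : probability (measurableTypeR R) R).
Hypothesis hmu : is_mu alpha mu.

Lemma corr_f_alpha_bounds k J r : (1 <= k)%N -> J !=set0 ->
  #|close_set alpha k J (r - alpha ^+ k)|%:R / ((2 ^ k) ^ 2)%:R <= corr f mu J r
  <= #|close_set alpha k J (r + alpha ^+ k)|%:R / ((2 ^ k) ^ 2)%:R.
Proof.
move=> k1 J0.
have gu x : 0 <= x <= 1 -> 0 <= f x <= 1 by exact: f_alpha_unit.
have mS : measurable (corr_set f J r).
  by apply: measurable_corr_set => //; exact: measurable_f_alpha.
have E1 := @trivIset_cyln _ _ ha k; have E2 (n : 'I_(2 ^ k)) := is_mu_cyln n hmu k1.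
have Em (n : 'I_(2 ^ k)) : measurable (cyln alpha k n) by exact: measurable_itv.
(* The error is alpha^k rather than twice that: each point exceeds its left endpoint by an amount in
   [0, alpha^k], and the two amounts are subtracted. *)
have near m n x y i : cyln alpha k m x -> cyln alpha k n y ->
    `| (iter i f x - iter i f y) - (kap k (i + m) - kap k (i + n))| <= alpha ^+ k.
  move=> /(iter_f_alpha_cyln i); rewrite /cyln /= in_itv/= => /andP[h1 h2].
  move=> /(iter_f_alpha_cyln i); rewrite /cyln /= in_itv/= => /andP[h3 h4].
  by rewrite ler_norml; apply/andP; split; lra.
apply/andP; split.
  apply: (corr_ge Em E1 E2) => //.
  move=> p /close_setP h [x y] [/= xE yE].
  split => /=; [by rewrite in_itv/= (cyln_unit xE)|by rewrite in_itv/= (cyln_unit yE)|].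
  apply/(rho_leP _ gu J0 (cyln_unit xE) (cyln_unit yE)) => i Ji.
  have := h i Ji; have := near _ _ _ _ i xE yE.
  by rewrite !ler_norml => /andP[? ?] /andP[? ?]; apply/andP; split; lra.
apply: (corr_le Em E1 E2) => //.
- by rewrite expn_gt0.
- move=> p [x y] [_ _ /= h] /= xE yE; apply/close_setP => i Ji.
  have := (rho_leP _ gu J0 (cyln_unit xE) (cyln_unit yE)).1 h i Ji.
  have := near _ _ _ _ i xE yE.
  by rewrite !ler_norml => /andP[? ?] /andP[? ?]; apply/andP; split; lra.
Qed.

(** The counting bound is used at s = r for one side and at s = r - alpha^k for the other; dividing
    B 2^k by 4^k gives the right-hand side. *)
Lemma corr_dist k J r B : (1 <= k)%N -> J !=set0 ->
  (forall s, (#|close_set alpha k J (s + alpha ^+ k) :\: close_set alpha k J s|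
     <= B * 2 ^ k)%N) ->
  `|corr (f_trunc alpha k) (mu_trunc alpha k) J r - corr f mu J r|
    <= B%:R / 2 ^+ k.
Proof.
move=> k1 J0 hB; rewrite (corr_f_trunc _ k1 J0).
have /andP[lo hi] := corr_f_alpha_bounds r k1 J0.
have step s : #|close_set alpha k J (s + alpha ^+ k)|%:R / ((2 ^ k) ^ 2)%:R
    <= #|close_set alpha k J s|%:R / ((2 ^ k) ^ 2)%:R + B%:R / 2 ^+ k :> R.
  have -> : B%:R / 2 ^+ k = (B * 2 ^ k)%:R / ((2 ^ k) ^ 2)%:R :> R.
    by rewrite !natrX natrM natrX; field; rewrite expf_neq0// pnatr_eq0.
  rewrite -mulrDl ler_wpM2r ?invr_ge0// -natrD ler_nat.
  rewrite -(cardsID (close_set alpha k J s) (close_set alpha k J (s + alpha ^+ k))).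
  by rewrite leq_add// subset_leq_card// finset.subsetIr.
have := step r; have := step (r - alpha ^+ k); rewrite subrK => s1 s2.
by rewrite ler_norml; apply/andP; split; lra.
Qed.

Lemma card_close_set1_ge k h s : (h < k)%N -> alpha ^+ h.+1 <= s ->
  (2 ^ k * 2 ^ (k - h - 1) <= #|close_set alpha k `I_1 s|)%N.
Proof.
move=> hk hs.
(* The second word takes its first h + 1 letters from [p.1] and the remaining k - h - 1 letters from
   [p.2]. *)
have lt (p : 'I_(2 ^ k) * 'I_(2 ^ (k - h - 1))) : (val p.1 %% 2 ^ h.+1 + 2 ^ h.+1 * val p.2 < 2 ^ k)%N.
  case: p => [[m mk] [q qk]] /=.
  have -> : (2 ^ k = 2 ^ h.+1 * 2 ^ (k - h - 1))%N by rewrite -expnD; congr (2 ^ _)%N; lia.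
  have : (m %% 2 ^ h.+1 < 2 ^ h.+1)%N by rewrite ltn_mod expn_gt0.
  have : (2 ^ h.+1 * q.+1 <= 2 ^ h.+1 * 2 ^ (k - h - 1))%N by rewrite leq_mul2l qk orbT.
  by rewrite mulnS; lia.
pose F (p : 'I_(2 ^ k) * 'I_(2 ^ (k - h - 1))) := (p.1, Ordinal (lt p)).
have Finj : injective F.
  move=> [m q] [m' q'] [/= -> /eqP]; rewrite eqn_add2l eqn_pmul2l ?expn_gt0// => /eqP e.
  by congr (_, _); exact: val_inj.
rewrite -[X in (X * _)%N]card_ord -[X in (_ * X)%N]card_ord -card_prod -(card_imset _ Finj).
apply/subset_leq_card/fintype.subsetP => y /imsetP[p _ ->]; apply/close_setP => i.
rewrite /= ltnS leqn0 => /eqP ->; rewrite !add0n (le_trans _ hs)//.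
by apply: kappan_near => //; rewrite addnC mulnC modnMDl modn_mod.
Qed.

Lemma close_setT_subset k s : close_set alpha k setT s \subset close_set alpha k `I_1 s.
Proof. by apply/fintype.subsetP => p /close_setP h; apply/close_setP => i _; apply: h. Qed.

(** With q = 2^(k-h-1) and N = 2^k, both correlations change by at most 2/N, and the denominator for
    [f_alpha] is at least (q - 2)/N. Then [norm_ratioB] bounds the difference by (4/N) / ((q -
    2)/N). *)
Lemma det_oo_dist h k r : (1 <= k)%N -> alpha ^+ h.+1 <= r ->
  2 < 2 ^+ (k - h - 1) :> R ->
  `|det_oo f mu r - det_oo (f_trunc alpha k) (mu_trunc alpha k) r|
    <= 4 / (2 ^+ (k - h - 1) - 2).
Proof.
move=> k1 hr q2.
have hk : (h < k)%N.
  (* If k <= h, truncated subtraction makes the power equal to 1, against [q2]. *)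
  by rewrite -subn_gt0 lt0n; apply/eqP => e; move: q2; rewrite e sub0n expr0; lra.
have I1 : `I_1 !=set0 by exists 0%N.
have T1 : [set: nat] !=set0 by exists 0%N.
have b1 := corr_dist r k1 I1 (card_closeD ha k 1).
have b2 := corr_dist r k1 T1 (card_closeD_setT ha k).
have N0 : 0 < 2 ^+ k :> R by rewrite exprn_gt0.
have b'1 : 2 ^+ (k - h - 1) / 2 ^+ k <= corr (f_trunc alpha k) (mu_trunc alpha k) `I_1 r.
  rewrite (corr_f_trunc _ k1 I1).
  have -> : 2 ^+ (k - h - 1) / 2 ^+ k = (2 ^ k * 2 ^ (k - h - 1))%:R / ((2 ^ k) ^ 2)%:R :> R.
    by rewrite natrM !natrX; field; rewrite gt_eqF.
  by rewrite ler_wpM2r ?invr_ge0// ler_nat card_close_set1_ge.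
have a'1 : 0 <= corr (f_trunc alpha k) (mu_trunc alpha k) setT r <=
    corr (f_trunc alpha k) (mu_trunc alpha k) `I_1 r.
  rewrite (corr_f_trunc _ k1 I1) (corr_f_trunc _ k1 T1) divr_ge0//=.
  by rewrite ler_wpM2r ?invr_ge0// ler_nat subset_leq_card// close_setT_subset.
rewrite /det_oo; move: b1 b2 b'1 a'1; rewrite muln1.
move: (corr _ _ _ _) (corr _ _ _ _) (corr _ _ _ _) (corr _ _ _ _) => a a' b b'.
set q := 2 ^+ (k - h - 1) in q2 *; set N := 2 ^+ k in N0 *.
clearbody q N => b1 b2 b'1 a'1.
have bl : (q - 2) / N <= b.
  by move: b1; rewrite ler_norml mulrBl => /andP[? ?]; lra.
have q0 : 0 < q - 2 by lra.
have bl0 : 0 < (q - 2) / N by rewrite divr_gt0.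
have bp : 0 < b by exact: lt_le_trans bl.
have b'p : 0 < b' by apply: lt_le_trans b'1; rewrite divr_gt0//; lra.
apply: le_trans (norm_ratioB a bp b'p a'1) _.
rewrite ler_pdivrMr// (le_trans _ (ler_wpM2l _ bl)) ?divr_ge0 ?(ltW q0)//.
rewrite (distrC a) (distrC b) (_ : 4 / _ * _ = 2 / N + 2 / N) ?lerD//.
by field; rewrite !gt_eqF.
Qed.

End Comparison.

Unset Implicit Arguments.

Theorem corollary22 (R : realType) (alpha r : R)
    (mu : probability (measurableTypeR R) R)
    (halpha : 0 < alpha < 1 / 2) (hr : 0 < r <= 1) (hmu : is_mu alpha mu) :
  (forall k : nat, (1 <= k)%N -> alpha ^+ k < r ->
    [/\ `|corr (f_trunc alpha k) (mu_trunc alpha k) `I_1 r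
          - corr (f_alpha alpha) mu `I_1 r| < 8 / 2 ^+ k,
        forall l : nat, (1 < l)%N ->
          `|corr (f_trunc alpha k) (mu_trunc alpha k) `I_l r
            - corr (f_alpha alpha) mu `I_l r| < 16 * l%:R / 2 ^+ k
      & `|corr (f_trunc alpha k) (mu_trunc alpha k) setT r
          - corr (f_alpha alpha) mu setT r| < 4 / 2 ^+ k])
  /\
  (forall h k : nat, alpha ^+ h.+1 < r <= alpha ^+ h ->
    (1 <= k)%N -> alpha ^+ k < r -> 0 < (2 ^+ (k - h - 1)%N - 8 : R) ->
    `|det_oo (f_alpha alpha) mu r - det_oo (f_trunc alpha k) (mu_trunc alpha k) r|
      <= 24 / (2 ^+ (k - h - 1)%N - 8)).
Proof.
split=> [k k1 _|h k /andP[hr' _] k1 _ q8].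
  have N0 : 0 < (2 ^+ k)^-1 :> R by rewrite invr_gt0 exprn_gt0.
  (* Counting gives the constants 2 l and, for l = oo, 2; they are below the stated ones, whence the
     strict inequalities. *)
  have bl l : (0 < l)%N -> `|corr (f_trunc alpha k) (mu_trunc alpha k) `I_l r
      - corr (f_alpha alpha) mu `I_l r| <= (2 * l)%:R / 2 ^+ k.
    by move=> l0; apply: corr_dist (card_closeD halpha k l) => //; exists 0%N.
  split=> [|l l1|].
  - by apply: le_lt_trans (bl 1%N _) _; rewrite // muln1 ltr_pM2r// ltr_nat.
  - apply: le_lt_trans (bl l _) _; first exact: ltnW.
    by rewrite natrM ltr_pM2r// ltr_pM2r ?ltr_nat// ltr0n ltnW.
  - apply: (@le_lt_trans _ _ (2 / 2 ^+ k)); last by rewrite ltr_pM2r// ltr_nat.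
    by apply: corr_dist (card_closeD_setT halpha k) => //; exists 0%N.
have q2 : 2 < 2 ^+ (k - h - 1) :> R by lra.
apply: le_trans (det_oo_dist halpha hmu k1 (ltW hr') q2) _.
(* Numerators and denominators compare separately: 4 <= 24 and 0 < q - 8 <= q - 2 for q =
   2^(k-h-1). *)
rewrite ler_pM// ?invr_ge0 ?lef_pV2 ?posrE; lra.
Qed.
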